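(* Let $\delta\in\mathbb{C}$ and let $L$ be a symmetric $\delta$-Leibniz algebra over $\mathbb{C}$. Then: (A) if $\delta\neq\tfrac12$, then $x^n=0$ for all $x\in L$ and all $n>2$; (B) if $\delta=\tfrac12$, then $L$ is power-associative.
   Context: An algebra means a complex vector space with a bilinear multiplication, not assumed associative. A (right) $\delta$-Leibniz algebra satisfies $(xy)z=\delta\big((xz)y+x(yz)\big)$; a left $\delta$-Leibniz algebra satisfies $x(yz)=\delta\big((xy)z+y(xz)\big)$. A symmetric $\delta$-Leibniz algebra is one that is both left and right $\delta$-Leibniz. The assertion $x^n=0$ means that every product of $n$ copies of $x$, with any bracketing, is zero. An algebra is power-associative if the subalgebra generated by any single element is associative. *)

(* Defs.v *)
(* The complex numbers are rendered as R[i] for an arbitrary R : realType. *)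
From mathcomp Require Export all_boot all_order all_algebra.
From mathcomp Require Export classical_sets reals complex.

Set Implicit Arguments.
Unset Strict Implicit.
Unset Printing Implicit Defensive.

Import GRing.Theory.

Local Open Scope classical_set_scope.
Local Open Scope ring_scope.

(* A nonassociative K-algebra is a K-vector space L (of any dimension) together
   with a bilinear map mul : {bilinear L -> L -> L}. *)
Section NonassociativeAlgebra.
Variables (K : fieldType) (L : lmodType K) (mul : {bilinear L -> L -> L}).

Local Notation "x ** y" := (mul x y) (at level 40, left associativity).

Definition right_delta_leibniz (delta : K) : Prop :=
  forall x y z : L, (x ** y) ** z = delta *: ((x ** z) ** y + x ** (y ** z)).

Definition left_delta_leibniz (delta : K) : Prop :=
  forall x y z : L, x ** (y ** z) = delta *: ((x ** y) ** z + y ** (x ** z)).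

Definition symmetric_delta_leibniz (delta : K) : Prop :=
  left_delta_leibniz delta /\ right_delta_leibniz delta.

(* bracketing x n u: u is the value of some bracketing of the product of n
   copies of x. *)
Inductive bracketing (x : L) : nat -> L -> Prop :=
| bracketing1 : bracketing x 1 x
| bracketingM m n u v : bracketing x m u -> bracketing x n v ->
    bracketing x (m + n) (u ** v).

(* x ^ n = 0 means that every bracketing of n copies of x vanishes. *)
Definition power_eq0 (x : L) (n : nat) : Prop :=
  forall u : L, bracketing x n u -> u = 0.

Definition subalgebra (S : set L) : Prop :=
  [/\ S 0,
      forall (a : K) (u v : L), S u -> S v -> S (a *: u + v) &
      forall u v : L, S u -> S v -> S (u ** v)].

Definition generated_subalgebra (G : set L) : set L := smallest subalgebra G.

Definition associative_on (S : set L) : Prop :=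
  forall u v w : L, S u -> S v -> S w -> (u ** v) ** w = u ** (v ** w).

Definition power_associative : Prop :=
  forall x : L, associative_on (generated_subalgebra [set x]).

End NonassociativeAlgebra.

(* Main.v *)
Require Import Defs.
From mathcomp Require Import all_boot all_order all_algebra.
From mathcomp Require Import classical_sets reals complex.
Local Open Scope ring_scope.

Set Implicit Arguments.
Unset Strict Implicit.
Unset Printing Implicit Defensive.

Import GRing.Theory Num.Theory.

(** Everything happens on products of copies of a single element [x].

    For [delta] different from one half, the two Leibniz laws at [(x, x, x)]
    express both [(xx)x] and [x(xx)] as [delta] times their sum; so they agree
    and are fixed by multiplication by [2 delta], hence vanish
    ([leibniz_cube_eq0]).  In larger degree, a product with a factor of degree
    at least three vanishes by induction.  This leaves only [(xx)(xx)], which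
    the right law rewrites as a combination of products with factor [x(xx)]
    ([power_eq0_gt2]).

    For [delta] equal to one half, let [x^n] be the left-normed powers and
    suppose that [x^a x^b = x^(a+b)] in degrees
    below [N].  The left law at [(x^a, x^b, x)] with [a + b + 1 = N] reads
    [2 x^a x^(b+1) = x^N + x^b x^(a+1)].  Subtracting the same equation with
    [a] and [b] exchanged gives [3 x^a x^(b+1) = 3 x^b x^(a+1)], so both are
    equal to [x^N] ([lpowM]).  The powers thus multiply as in a one-generated
    semigroup, their linear span is an associative subalgebra, and it contains
    the one generated by [x]. *)

Section LeibnizPowers.
Variables (K : fieldType) (L : lmodType K) (mul : {bilinear L -> L -> L}).

Local Notation "x ** y" := (mul x y) (at level 40, left associativity).

Lemma bracketing_gt0 x n u : bracketing mul x n u -> (0 < n)%N.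
Proof. by elim=> // m k v w _ m_gt0 _ _; rewrite addn_gt0 m_gt0. Qed.

Lemma bracketing_1 x u : bracketing mul x 1 u -> u = x.
Proof.
move En: 1%N => n Bu; case: Bu En => // m k v w Bv Bw.
by case: m k {Bv Bw} (bracketing_gt0 Bv) (bracketing_gt0 Bw) => [|[|m]] [].
Qed.

Lemma bracketing_2 x u : bracketing mul x 2 u -> u = x ** x.
Proof.
move En: 2%N => n Bu; case: Bu En => // m k v w Bv Bw.
have := bracketing_gt0 Bw; have := bracketing_gt0 Bv.
case: m k Bv Bw => [|[|[|m]]] [|[|k]] //= Bv Bw _ _ _.
by rewrite (bracketing_1 Bv) (bracketing_1 Bw).
Qed.

(** The two laws give both cubes the same value [delta *: (p + q)]. *)
Lemma leibniz_cube_eq0 (delta : K) (x : L) :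
  symmetric_delta_leibniz mul delta -> delta *+ 2 != 1 ->
  (x ** x) ** x = 0 /\ x ** (x ** x) = 0.
Proof.
move=> [left_law right_law] delta_neq.
have Ep := right_law x x x; have Eq := left_law x x x.
have Epq : x ** (x ** x) = (x ** x) ** x by rewrite Eq -Ep.
suff p0 : (x ** x) ** x = 0 by rewrite Epq.
move: Ep; rewrite Epq -mulr2n -scalerMnr scalerMnl => /eqP.
rewrite -subr_eq0 -{1}[mul _ _]scale1r -scalerBl scaler_eq0 subr_eq0.
by rewrite eq_sym (negPf delta_neq) => /eqP.
Qed.

Lemma power_eq0_gt2 (delta : K) (x : L) (n : nat) :
  symmetric_delta_leibniz mul delta -> delta *+ 2 != 1 ->
  (2 < n)%N -> power_eq0 mul x n.
Proof.
move=> leibL delta_neq n_gt2 u Bu.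
have [p0 q0] := leibniz_cube_eq0 x leibL delta_neq.
have sq0 : (x ** x) ** (x ** x) = 0.
  by rewrite (proj2 leibL) q0 linear0l linear0r addr0 scaler0.
elim: Bu n_gt2 => // m k v w Bv IHv Bw IHw.
have [/IHv-> | m_le2] := ltnP 2 m; first by rewrite linear0l.
have [/IHw-> | k_le2] := ltnP 2 k; first by rewrite linear0r.
have := bracketing_gt0 Bw; have := bracketing_gt0 Bv.
case: m k m_le2 k_le2 Bv Bw {IHv IHw} => [|[|[|m]]] [|[|[|k]]] // _ _ Bv Bw _ _ _.
- by rewrite (bracketing_1 Bv) (bracketing_2 Bw).
- by rewrite (bracketing_2 Bv) (bracketing_1 Bw).
- by rewrite (bracketing_2 Bv) (bracketing_2 Bw).
Qed.

(** The exponent is shifted, as there is no unit: [lpow x n] has [n.+1]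
    factors. *)
Definition lpow (x : L) (n : nat) : L := iter n (fun u => u ** x) x.

(** Subtracting the two equations gives [3 (h - h') = 0]. *)
Lemma double_swap_eq (h h' X : L) :
  (3%:R : K) != 0 -> h *+ 2 = X + h' -> h' *+ 2 = X + h -> h = X.
Proof.
move=> three_neq0 Eh Eh'.
suff Ehh' : h = h' by apply: (addIr h'); rewrite -Eh -Ehh' mulr2n.
suff : (3%:R : K) *: (h - h') == 0.
  by rewrite scaler_eq0 (negPf three_neq0) subr_eq0 => /eqP.
rewrite scaler_nat mulrSr mulrnBl Eh Eh' opprD [X + h' + _]addrACA subrr add0r.
by rewrite subrKA subrr.
Qed.

(** Induction on the degree.  The left law is applied with last argument [x]
    because [lpow x d ** x] is [lpow x d.+1] by definition, so that the only
    products of top degree are the two that get exchanged with [c] and [d]. *)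
Lemma lpowM (x : L) (a b : nat) :
  (3%:R : K) != 0 -> (2%:R : K) != 0 -> left_delta_leibniz mul 2%:R^-1 ->
  lpow x a ** lpow x b = lpow x (a + b).+1.
Proof.
move=> three_neq0 two_neq0 left_law.
have [N leN] := ubnP (a + b); elim: N a b leN => // N IHN a [|b] leN.
  by rewrite addn0.
have law c d : (c + d < N)%N ->
    (lpow x c ** lpow x d.+1) *+ 2 =
      lpow x (c + d).+2 + lpow x d ** lpow x c.+1.
  move=> lt_cd; rewrite -scaler_nat [lpow x d.+1]/= left_law.
  by rewrite scalerA divff // scale1r IHN.
have lt_ab : (a + b < N)%N by rewrite -ltnS -addnS.
rewrite addnS; apply: (double_swap_eq three_neq0 (law a b lt_ab)).
by rewrite law addnC.
Qed.

Inductive lpow_span (x : L) : L -> Prop :=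
| lpow_span0 : lpow_span x 0
| lpow_spanD a n u : lpow_span x u -> lpow_span x (a *: lpow x n + u).

Lemma lpow_span_lpow x n : lpow_span x (lpow x n).
Proof.
by rewrite -[lpow x n]addr0 -[lpow x n]scale1r; do 2!constructor.
Qed.

Lemma lpow_span_linear x a u v :
  lpow_span x u -> lpow_span x v -> lpow_span x (a *: u + v).
Proof.
move=> Su Sv; elim: Su => [|b n w _ IHw]; first by rewrite scaler0 add0r.
by rewrite scalerDr scalerA -addrA; constructor.
Qed.

Lemma lpow_span_mul x u v :
  (forall a b, lpow x a ** lpow x b = lpow x (a + b).+1) ->
  lpow_span x u -> lpow_span x v -> lpow_span x (u ** v).
Proof.
move=> powM Su Sv; elim: Su => [|a m w _ IHw]; first by rewrite linear0l; constructor.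
rewrite linearPl; apply: lpow_span_linear => //.
elim: Sv => [|b n t _ IHt]; first by rewrite linear0r; constructor.
by rewrite linearPr /= powM; apply: lpow_span_linear; first exact: lpow_span_lpow.
Qed.

(** By trilinearity, associativity on the span reduces to the powers. *)
Lemma lpow_span_assoc x :
  (forall a b, lpow x a ** lpow x b = lpow x (a + b).+1) ->
  associative_on mul (lpow_span x).
Proof.
move=> powM u v w Su Sv Sw.
elim: Su => [|a m u' _ IHu]; first by rewrite !linear0l.
rewrite !linearPl IHu; congr (_ *: _ + _).
elim: Sv => [|b n v' _ IHv]; first by rewrite !(linear0l, linear0r).
rewrite !(linearPl, linearPr) /= IHv; congr (_ *: _ + _).
elim: Sw => [|c k w' _ IHw]; first by rewrite !linear0r.
by rewrite !linearPr /= IHw !powM addSn addnS addnA.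
Qed.

Lemma half_leibniz_power_associative :
  (3%:R : K) != 0 -> (2%:R : K) != 0 -> left_delta_leibniz mul 2%:R^-1 ->
  power_associative mul.
Proof.
move=> three_neq0 two_neq0 left_law x.
have powM a b := lpowM x a b three_neq0 two_neq0 left_law.
have gen_sub : (generated_subalgebra mul [set x] `<=` lpow_span x)%classic.
  apply: smallest_sub => [|_ ->]; last exact: (lpow_span_lpow x 0).
  split=> [|a u v|u v]; first exact: lpow_span0.
    exact: lpow_span_linear.
  exact: lpow_span_mul.
by move=> u v w /gen_sub Su /gen_sub Sv /gen_sub Sw; apply: lpow_span_assoc Sw.
Qed.

End LeibnizPowers.

Theorem theorem31 (R : realType) (delta : R[i]) (L : lmodType R[i])
    (mul : {bilinear L -> L -> L}) (hL : symmetric_delta_leibniz mul delta) :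
  (delta <> 1 / 2%:R ->
     forall (x : L) (n : nat), (2 < n)%N -> power_eq0 mul x n) /\
  (delta = 1 / 2%:R -> power_associative mul).
Proof.
split=> [delta_neq x n | Edelta].
  apply: power_eq0_gt2 hL _; apply: contra_not_neq delta_neq => two_delta.
  by rewrite -[X in X / _]two_delta -[delta *+ 2]mulr_natr mulfK ?pnatr_eq0.
apply: half_leibniz_power_associative; rewrite ?pnatr_eq0 //.
by move: hL => []; rewrite Edelta div1r.
Qed.
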